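(* The category $\mathbf{NG}_0$ of pointed numerically generated spaces is a symmetric monoidal closed category with tensor product the smash product $\wedge$ and with internal hom from $Y$ to $Z$ given by $Z^Y = \nu\,\mathbf{smap}_0(Y,Z)$.
   Context: A topological space $X$ is numerically generated if it has the final topology with respect to all its singular simplexes (continuous maps $\Delta^n \to X$, $n\ge 0$). $\mathbf{NG}$ is the full subcategory of topological spaces consisting of numerically generated spaces, and $\mathbf{NG}_0$ is the category of pointed objects of $\mathbf{NG}$ and basepoint preserving continuous maps. For a topological space $X$, $\nu X$ is the underlying set of $X$ with the final topology with respect to all continuous maps into $X$ from open subsets of Euclidean spaces (equivalently, with respect to the singular simplexes of $X$). A map $f\colon X\to Y$ of topological spaces is numerically continuous if $f\sigma$ is continuous for every singular simplex $\sigma\colon\Delta^n\to X$. $\mathbf{smap}(X,Y)$ is the set of numerically continuous maps with the initial topology with respect to the maps $\sigma^*\colon \mathbf{smap}(X,Y)\to \mathbf{map}(\Delta^n,Y)$, $f\mapsto f\sigma$, for all singular simplexes $\sigma$ of $X$, where $\mathbf{map}(\Delta^n,Y)$ is the set of continuous maps with the compact-open topology. For pointed $X,Y$, $\mathbf{smap}_0(X,Y)\subset\mathbf{smap}(X,Y)$ is the subspace of basepoint preserving maps, with the constant map as basepoint. For $X,Y\in\mathbf{NG}_0$ with basepoints $x_0,y_0$, the smash product $X\wedge Y$ is the quotient of $X\times Y$ (the product in $\mathbf{NG}$, i.e. $\nu$ of the topological product) by the subspace $X\vee Y = X\times\{y_0\}\cup\{x_0\}\times Y$. *)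

(* Defs.v *)
From HB Require Import structures.
From mathcomp Require Import all_boot all_order all_algebra.
From mathcomp Require Import all_classical reals topology normedtype.
From mathcomp Require Import lra.

Set Implicit Arguments.
Unset Strict Implicit.
Unset Printing Implicit Defensive.

Import Order.TTheory GRing.Theory Num.Theory.
Import numFieldNormedType.Exports.

Local Open Scope classical_set_scope.
Local Open Scope ring_scope.
Local Open Scope quotient_scope.

Record category := Category {
  cat_obj :> Type;
  hom : cat_obj -> cat_obj -> Type;
  cat_id : forall X : cat_obj, hom X X;
  cat_comp : forall X Y Z : cat_obj, hom Y Z -> hom X Y -> hom X Z;
  cat_comp1f : forall (X Y : cat_obj) (f : hom X Y), cat_comp (cat_id Y) f = f;
  cat_compf1 : forall (X Y : cat_obj) (f : hom X Y), cat_comp f (cat_id X) = f;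
  cat_compA : forall (W X Y Z : cat_obj) (h : hom Y Z) (g : hom X Y) (f : hom W X),
    cat_comp h (cat_comp g f) = cat_comp (cat_comp h g) f
}.
Arguments hom {c} X Y : rename.
Arguments cat_id {c} X : rename.
Arguments cat_comp {c X Y Z} g f : rename.

Declare Scope category_scope.
Delimit Scope category_scope with cat.
Local Open Scope category_scope.
Notation "g '\c' f" := (cat_comp g f)
  (at level 50, left associativity, format "g  '\c'  f") : category_scope.

Definition opposite (C : category) : category := {|
  cat_obj := cat_obj C;
  hom := fun X Y => @hom C Y X;
  cat_id := fun X => @cat_id C X;
  cat_comp := fun X Y Z g f => @cat_comp C Z Y X f g;
  cat_comp1f := fun X Y f => @cat_compf1 C Y X f;
  cat_compf1 := fun X Y f => @cat_comp1f C Y X f;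
  cat_compA := fun W X Y Z h g f => esym (@cat_compA C Z Y X W f g h)
|}.

Definition is_iso (C : category) (X Y : C) (f : hom X Y) : Prop :=
  exists g : hom Y X, g \c f = cat_id X /\ f \c g = cat_id Y.

Record bifunctor (C D E : category) := Bifunctor {
  bf_obj :> C -> D -> E;
  bf_map : forall (X X' : C) (Y Y' : D),
    hom X X' -> hom Y Y' -> hom (bf_obj X Y) (bf_obj X' Y');
  bf_id : forall (X : C) (Y : D),
    bf_map (cat_id X) (cat_id Y) = cat_id (bf_obj X Y);
  bf_comp : forall (X X' X'' : C) (Y Y' Y'' : D)
      (f' : hom X' X'') (f : hom X X') (g' : hom Y' Y'') (g : hom Y Y'),
    bf_map (f' \c f) (g' \c g) = bf_map f' g' \c bf_map f g
}.
Arguments bf_map {C D E} b {X X' Y Y'} f g : rename.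

Record symmetric_monoidal (C : category) (T : bifunctor C C C) := {
  sm_unit : C;
  sm_assoc : forall X Y Z : C, hom (T (T X Y) Z) (T X (T Y Z));
  sm_lunit : forall X : C, hom (T sm_unit X) X;
  sm_runit : forall X : C, hom (T X sm_unit) X;
  sm_braid : forall X Y : C, hom (T X Y) (T Y X);
  sm_assoc_iso : forall X Y Z : C, is_iso (sm_assoc X Y Z);
  sm_lunit_iso : forall X : C, is_iso (sm_lunit X);
  sm_runit_iso : forall X : C, is_iso (sm_runit X);
  sm_assoc_nat : forall (X X' Y Y' Z Z' : C)
      (f : hom X X') (g : hom Y Y') (h : hom Z Z'),
    sm_assoc X' Y' Z' \c bf_map T (bf_map T f g) h =
    bf_map T f (bf_map T g h) \c sm_assoc X Y Z;
  sm_lunit_nat : forall (X X' : C) (f : hom X X'),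
    sm_lunit X' \c bf_map T (cat_id sm_unit) f = f \c sm_lunit X;
  sm_runit_nat : forall (X X' : C) (f : hom X X'),
    sm_runit X' \c bf_map T f (cat_id sm_unit) = f \c sm_runit X;
  sm_braid_nat : forall (X X' Y Y' : C) (f : hom X X') (g : hom Y Y'),
    sm_braid X' Y' \c bf_map T f g = bf_map T g f \c sm_braid X Y;
  sm_triangle : forall X Y : C,
    bf_map T (cat_id X) (sm_lunit Y) \c sm_assoc X sm_unit Y =
    bf_map T (sm_runit X) (cat_id Y);
  sm_pentagon : forall W X Y Z : C,
    sm_assoc W X (T Y Z) \c sm_assoc (T W X) Y Z =
    bf_map T (cat_id W) (sm_assoc X Y Z) \c sm_assoc W (T X Y) Z
      \c bf_map T (sm_assoc W X Y) (cat_id Z);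
  sm_hexagon : forall X Y Z : C,
    sm_assoc Y Z X \c sm_braid X (T Y Z) \c sm_assoc X Y Z =
    bf_map T (cat_id Y) (sm_braid X Z) \c sm_assoc Y X Z
      \c bf_map T (sm_braid X Y) (cat_id Z);
  sm_symmetry : forall X Y : C, sm_braid Y X \c sm_braid X Y = cat_id (T X Y)
}.

(** [H Y Z] is the internal hom from [Y] to [Z]: each [H Y] is right adjoint
    to [fun X => T X Y], by a bijection that is natural in all variables. *)
Record monoidal_closed (C : category) (T : bifunctor C C C)
    (H : bifunctor (opposite C) C C) := {
  mc_curry : forall X Y Z : C, hom (T X Y) Z -> @hom C X (H Y Z);
  mc_curry_bij : forall X Y Z : C, bijective (@mc_curry X Y Z);
  mc_curry_nat : forall (X X' Y Y' Z Z' : C)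
      (a : hom X' X) (b : hom Y' Y) (c : hom Z Z') (f : hom (T X Y) Z),
    mc_curry (c \c f \c bf_map T a b) =
    @bf_map _ _ _ H Y Y' Z Z' b c \c mc_curry f \c a
}.

Record symmetric_monoidal_closed (C : category) (T : bifunctor C C C)
    (H : bifunctor (opposite C) C C) := {
  smc_symmetric_monoidal : symmetric_monoidal T;
  smc_closed : monoidal_closed T H
}.

Definition to_set_type (T : Type) (A : set T) (x : T) (Ax : A x) : A :=
  exist (fun x => x \in A) x (mem_set Ax).

Definition simplex (R : realType) (n : nat) : set 'rV[R]_n.+1 :=
  [set t | (forall i, 0 <= t 0 i) /\ \sum_i t 0 i = 1].
Arguments simplex : clear implicits.

Definition numerically_generated (R : realType) (X : topologicalType) : Prop :=
  forall U : set X, open U <->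
    forall (n : nat) (s : simplex R n -> X), continuous s -> open (s @^-1` U).

(** [nu R X] carries the final topology with respect to all continuous maps
    into [X] from open subsets of Euclidean spaces. *)
Definition nu (R : realType) (X : Type) : Type := X.
HB.instance Definition _ (R : realType) (X : choiceType) :=
  Choice.on (nu R X).
HB.instance Definition _ (R : realType) (X : pointedType) :=
  Pointed.on (nu R X).

Section nu_topology.
Variables (R : realType) (X : topologicalType).

Definition nu_open (U : set (nu R X)) : Prop :=
  forall (n : nat) (D : set 'rV[R]_n) (f : D -> X),
    open D -> continuous f -> open (f @^-1` U).

Let nu_openT : nu_open setT.
Proof. by move=> n D f _ _; rewrite preimage_setT; exact: openT. Qed.

Let nu_openI : setI_closed nu_open.
Proof.
by move=> A B oA oB n D f oD cf; rewrite preimage_setI; apply: openI;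
  [exact: oA|exact: oB].
Qed.

Let nu_open_bigU (I : Type) (F : I -> set (nu R X)) :
  (forall i, nu_open (F i)) -> nu_open (\bigcup_i F i).
Proof.
move=> oF n D f oD cf; rewrite preimage_bigcup; apply: bigcup_open => i _.
exact: oF.
Qed.

HB.instance Definition _ :=
  isOpenTopological.Build (nu R X) nu_openT nu_openI nu_open_bigU.

End nu_topology.

HB.instance Definition _ (R : realType) (X : ptopologicalType) :=
  Pointed.on (nu R X).

Lemma continuous_mx (R : realType) (T : topologicalType) (m n : nat)
    (f : T -> 'M[R]_(m, n)) :
  (forall i j, continuous (fun t => f t i j)) -> continuous f.
Proof.
move=> cf t A [P PA sPA].
suff : \forall u \near t, forall i j, P i j (f u i j).
  by apply: filterS => u Pu; exact: sPA.
apply: (@filter_forall _ _ (fun i u => forall j, P i j (f u i j)) (nbhs t)) => i.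
apply: (@filter_forall _ _ (fun j u => P i j (f u i j)) (nbhs t)) => j.
exact: (cf i j t _ (PA i j)).
Qed.

(** [chart v e] embeds the standard simplex affinely in ['rV[R]_n] as a small
    neighbourhood of [v]: this is why a set that is open along all singular
    simplexes is open along all maps from open subsets of Euclidean spaces. *)
Section simplex_chart.
Variables (R : realType) (n : nat) (v : 'rV[R]_n) (e : R).
Hypothesis e_gt0 : 0 < e.

Let c : R := n.+1%:R^-1.

Definition chart (t : simplex R n) : 'rV[R]_n :=
  \row_j (v 0 j + e * (val t 0 (lift ord0 j) - c)).

Let cochart (y : 'rV[R]_n) : 'rV[R]_n.+1 :=
  \row_i (if unlift ord0 i is Some j then c + e^-1 * (y 0 j - v 0 j)
          else c - \sum_j (e^-1 * (y 0 j - v 0 j))).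

Let c_gt0 : 0 < c.
Proof. by rewrite invr_gt0 ltr0n. Qed.

Let c_le1 : c <= 1.
Proof. by rewrite invf_le1 ?ltr0n// ler1n. Qed.

Lemma chart_continuous : continuous chart.
Proof.
apply: continuous_mx => i j t.
rewrite (_ : (fun _ => _) =
    fun t : simplex R n => v 0 j + e * (val t 0 (lift ord0 j) - c)); last first.
  by apply/funext => u; rewrite mxE.
have ct : (fun u : simplex R n => val u 0 (lift ord0 j)) @ t -->
    val t 0 (lift ord0 j).
  apply: (@continuous_comp _ _ _ (val : simplex R n -> _)
    (fun x : 'rV[R]_n.+1 => x 0 (lift ord0 j))).
    exact: initial_continuous.
  exact: coord_continuous.
exact: (cvgD (cvg_cst _) (cvgM (cvg_cst _) (cvgB ct (cvg_cst _)))).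
Qed.

Lemma chart_ball (t : simplex R n) : ball v (2 * e) (chart t).
Proof.
have [t_ge0 t1] := set_mem (valP t).
split=> [|i j]; first by rewrite mulr_gt0.
rewrite (ord1 i) mxE /ball/= opprD addrA subrr add0r normrN normrM gtr0_norm//.
rewrite mulrC ltr_pM2r//.
have t_le1 : val t 0 (lift ord0 j) <= 1.
  by rewrite -t1 (bigD1 (lift ord0 j))//= lerDl sumr_ge0.
have := t_ge0 (lift ord0 j); move: t_le1 c_gt0 c_le1 => t1' ? ? t0'.
by rewrite ltr_norml; apply/andP; split; lra.
Qed.

Let cochart_continuous : continuous cochart.
Proof.
have cy j : continuous (fun y : 'rV[R]_n => e^-1 * (y 0 j - v 0 j)).
  move=> y.
  exact: (cvgM (cvg_cst _) (cvgB (@coord_continuous _ _ _ _ _ y) (cvg_cst _))).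
apply: continuous_mx => i j y.
rewrite (_ : (fun _ => _) = fun y : 'rV[R]_n =>
    if unlift ord0 j is Some j' then c + e^-1 * (y 0 j' - v 0 j')
    else c - \sum_j' (e^-1 * (y 0 j' - v 0 j'))); last first.
  by apply/funext => u; rewrite mxE.
case: unliftP => [k _|_].
  exact: (cvgD (cvg_cst _) (cy k y)).
have cs : (fun u : 'rV[R]_n => \sum_j' (e^-1 * (u 0 j' - v 0 j'))) @ y -->
    \sum_j' (e^-1 * (y 0 j' - v 0 j')).
  apply: (@cvg_big _ _ _ _ _ add_continuous _ (nbhs y)) => k _.
  exact: cy.
exact: (cvgB (cvg_cst _) cs).
Qed.

Lemma chart_nbhs (V : set 'rV[R]_n) :
  open (chart @^-1` V) -> V v -> nbhs v V.
Proof.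
case=> W oW WV Vv.
have cv i : cochart v 0 i = c.
  rewrite mxE; case: unliftP => [j _|_]; first by rewrite subrr mulr0 addr0.
  by rewrite big1 ?subr0// => j _; rewrite subrr mulr0.
have cochart_sum y : \sum_i cochart y 0 i = 1.
  rewrite /cochart big_ord_recl mxE unlift_none.
  rewrite [X in _ + X](eq_bigr (fun j => c + e^-1 * (y 0 j - v 0 j))); last first.
    by move=> j _; rewrite mxE liftK.
  rewrite big_split/= sumr_const card_ord addrACA addNr addr0 -mulrS.
  by rewrite -[_ *+ _]mulr_natr mulVf// pnatr_eq0.
have cochart_ge0 : \forall y \near v, forall i, 0 <= cochart y 0 i.
  apply: (@filter_forall _ _ (fun i y => 0 <= cochart y 0 i)
    (nbhs v)) => i.
  have cvi : (fun y => cochart y 0 i) @ v --> c.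
    rewrite -[X in _ --> X](cv i).
    apply: (@continuous_comp _ _ _ cochart (fun x : 'rV[R]_n.+1 => x 0 i)).
      exact: cochart_continuous.
    exact: coord_continuous.
  by apply: filterS (cvgr_gt _ cvi _ c_gt0) => y /ltW.
have Wv : W (cochart v).
  have sv : cochart v \in simplex R n.
    by apply/mem_set; split=> // i; rewrite cv ltW.
  have : (val @^-1` W) (exist _ (cochart v) sv : simplex R n).
    rewrite WV /=; rewrite (_ : chart _ = v)//.
    by apply/rowP => j; rewrite mxE /= cv subrr mulr0 addr0.
  by [].
have nW : \forall y \near v, W (cochart y).
  by apply: cochart_continuous; exact: open_nbhs_nbhs.
apply: filterS2 nW cochart_ge0 => y Wy y_ge0.
have sy : cochart y \in simplex R n by apply/mem_set; split.
have : (chart @^-1` V) (exist _ (cochart y) sy : simplex R n) by rewrite -WV.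
rewrite /= (_ : chart _ = y)//.
apply/rowP => j; rewrite mxE /= mxE liftK addrAC subrr add0r mulrA.
by rewrite divff ?gt_eqF// mul1r addrC subrK.
Qed.

End simplex_chart.

Section numerically_generated_spaces.
Variable R : realType.

Lemma nu_numerically_generated (X : topologicalType) :
  numerically_generated R (nu R X).
Proof.
move=> U; split=> [oU n s cs|sU];
  first by move/continuousP : cs; apply.
change (nu_open U) => n D f oD cf.
have cfnu : continuous (f : D -> nu R X).
  by apply/continuousP => W oW; exact: oW.
rewrite openE => d /= Ufd; rewrite /interior.
have [r /= r_gt0 rD] : exists2 r : R, 0 < r & ball (val d) r `<=` D.
  have /nbhs_ballP[r /= r0 rD] : nbhs (val d) D.
    by apply: open_nbhs_nbhs; split=> //; exact: set_mem (valP d).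
  by exists r.
have e_gt0 : 0 < r / 2 by rewrite divr_gt0.
have chartD (t : simplex R n) : chart (val d) (r / 2) t \in D.
  apply/mem_set/rD; have := chart_ball (val d) e_gt0 t.
  by rewrite mulrC divfK ?pnatr_eq0.
pose tau (t : simplex R n) : D := exist (fun y => y \in D) _ (chartD t).
have ctau : continuous tau.
  by apply: continuous_comp_initial; exact: chart_continuous.
pose V : set 'rV[R]_n := val @` (f @^-1` U).
have nV : nbhs (val d) V.
  apply: (chart_nbhs e_gt0); last by exists d.
  rewrite (_ : _ @^-1` _ = tau @^-1` (f @^-1` U)).
    apply: (sU n (f \o tau)) => t.
    by apply: continuous_comp; [exact: ctau|exact: cfnu].
  apply/seteqP; split=> t /=; last by move=> Ut; exists (tau t).
  case=> d' /= Ud' dE; rewrite (_ : tau t = d')//; exact/val_inj.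
have : nbhs d (val @^-1` V) by exact: initial_continuous.
by apply: filterS => d' [d'' Ud'' /val_inj <-].
Qed.

Lemma quotient_numerically_generated (X : topologicalType) (Q : quotType X) :
  numerically_generated R X -> numerically_generated R (quotient_topology Q).
Proof.
move=> ngX U; split=> [oU n s cs|sU];
  first by move/continuousP : cs; apply.
apply/(ngX (\pi_(quotient_topology Q) @^-1` U)) => n s cs.
apply: (sU n (\pi_(quotient_topology Q) \o s)) => t.
by apply: continuous_comp; [exact: cs|exact: pi_continuous].
Qed.

Lemma nu_continuous (X Y : topologicalType) (f : X -> Y) :
  continuous f -> continuous (f : nu R X -> nu R Y).
Proof.
move=> cf; apply/continuousP => W oW.
change (nu_open (f @^-1` W : set (nu R X))) => n D g oD cg.
apply: (oW n D (f \o g)) => // t.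
by apply: continuous_comp; [exact: cg|exact: cf].
Qed.

End numerically_generated_spaces.

Record pointed_map (X Y : ptopologicalType) := PointedMap {
  pmap_fun :> X -> Y;
  pmap_continuous : continuous pmap_fun;
  pmap_point : pmap_fun point = point
}.

Lemma pointed_mapP (X Y : ptopologicalType) (f g : pointed_map X Y) :
  f =1 g -> f = g.
Proof.
case: f g => [f cf pf] [g cg pg] /= /funext fg.
by subst g; congr PointedMap; exact: Prop_irrelevance.
Qed.

Definition pmap_id (X : ptopologicalType) : pointed_map X X :=
  @PointedMap X X id (fun x => @cvg_id _ _) erefl.

Lemma pmap_comp_continuous (X Y Z : ptopologicalType)
    (g : pointed_map Y Z) (f : pointed_map X Y) : continuous (g \o f).
Proof.
by move=> x; apply: continuous_comp; exact: pmap_continuous.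
Qed.

Lemma pmap_comp_point (X Y Z : ptopologicalType)
    (g : pointed_map Y Z) (f : pointed_map X Y) : (g \o f) point = point.
Proof. by rewrite /= !pmap_point. Qed.

Definition pmap_comp (X Y Z : ptopologicalType)
    (g : pointed_map Y Z) (f : pointed_map X Y) : pointed_map X Z :=
  PointedMap (@pmap_comp_continuous _ _ _ g f) (pmap_comp_point g f).

Record NG0_space (R : realType) := NG0Space {
  ng_space :> ptopologicalType;
  ng_numerically_generated : numerically_generated R ng_space
}.

Program Definition NG0 (R : realType) : category := {|
  cat_obj := NG0_space R;
  hom := fun X Y => pointed_map X Y;
  cat_id := fun X => pmap_id X;
  cat_comp := fun X Y Z g f => pmap_comp g f
|}.
Next Obligation. by move=> R X Y f; exact: pointed_mapP. Qed.
Next Obligation. by move=> R X Y f; exact: pointed_mapP. Qed.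
Next Obligation. by move=> R W X Y Z h g f; exact: pointed_mapP. Qed.

Section smash.
Variables (R : realType) (X Y : ptopologicalType).

Local Notation XY := (nu R (X * Y)%type).

Definition wedge_in_prod : set XY := [set p | p.2 = point \/ p.1 = point].

(** Collapsing the nonempty subspace [wedge_in_prod] to a point. *)
Let smash_rel (p q : XY) : bool :=
  `[< p = q \/ wedge_in_prod p /\ wedge_in_prod q >].

Let smash_rel_refl : reflexive smash_rel.
Proof. by move=> p; apply/asboolP; left. Qed.

Let smash_rel_sym : symmetric smash_rel.
Proof.
by move=> p q; apply/asboolP/asboolP => -[->|[? ?]]; [left|right|left|right].
Qed.

Let smash_rel_trans : transitive smash_rel.
Proof.
move=> q p r /asboolP[->//|[wp wq]] /asboolP[<-|[_ wr]]; apply/asboolP; right;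
  by split.
Qed.

Definition smash_equiv : equiv_rel XY :=
  EquivRel smash_rel smash_rel_refl smash_rel_sym smash_rel_trans.

Definition smash : Type := quotient_topology {eq_quot smash_equiv}.

HB.instance Definition _ :=
  Quotient.copy smash (quotient_topology {eq_quot smash_equiv}).
HB.instance Definition _ :=
  Topological.copy smash (quotient_topology {eq_quot smash_equiv}).
HB.instance Definition _ :=
  isPointed.Build smash (\pi_smash (point : XY)).

Lemma smash_eqP (p q : XY) : \pi_smash p = \pi_smash q <->
  p = q \/ wedge_in_prod p /\ wedge_in_prod q.
Proof.
by split=> [/eqquotP/asboolP|pq]; last by apply/eqquotP/asboolP.
Qed.

End smash.


Lemma prod_map_continuous (X X' Y Y' : topologicalType)
    (f : X -> X') (g : Y -> Y') : continuous f -> continuous g ->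
  continuous (fun p : X * Y => (f p.1, g p.2)).
Proof.
move=> cf cg p; apply: cvg_pair.
  by apply: continuous_comp; [exact: cvg_fst|exact: cf].
by apply: continuous_comp; [exact: cvg_snd|exact: cg].
Qed.

Section smash_functor.
Variable R : realType.

Definition smash_obj (X Y : NG0 R) : NG0 R :=
  @NG0Space R (smash R X Y)
    (quotient_numerically_generated (@nu_numerically_generated R _)).

Section smash_map.
Variables (X X' Y Y' : ptopologicalType).
Variables (f : pointed_map X X') (g : pointed_map Y Y').

Let pair_map (p : nu R (X * Y)%type) : smash R X' Y' :=
  \pi_(smash R X' Y') (f p.1, g p.2).

Definition smash_map_fun : smash R X Y -> smash R X' Y' := pair_map \o repr.

Let pair_map_compat (p q : nu R (X * Y)%type) :
  \pi_(smash R X Y) p = \pi_(smash R X Y) q -> pair_map p = pair_map q.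
Proof.
move=> /smash_eqP[->//|[wp wq]]; apply/smash_eqP; right.
have wedge_map (u : nu R (X * Y)%type) : wedge_in_prod u ->
    @wedge_in_prod R X' Y' (f u.1, g u.2).
  by case=> /= ->; [left|right]; exact: pmap_point.
by split; exact: wedge_map.
Qed.

Lemma smash_map_pi (p : nu R (X * Y)%type) :
  smash_map_fun (\pi_(smash R X Y) p) = \pi_(smash R X' Y') (f p.1, g p.2).
Proof. by apply: pair_map_compat; rewrite reprK. Qed.

Lemma smash_map_continuous : continuous smash_map_fun.
Proof.
apply: repr_comp_continuous => [p|p q /eqP pq]; last first.
  by apply/eqP; exact: pair_map_compat.
apply: (@continuous_comp _ _ _
  ((fun p => (f p.1, g p.2)) : nu R (X * Y)%type -> nu R (X' * Y')%type)).
  by apply: nu_continuous; apply: prod_map_continuous; exact: pmap_continuous.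
exact: pi_continuous.
Qed.

Lemma smash_map_point : smash_map_fun point = point.
Proof. by rewrite [LHS]smash_map_pi /= !pmap_point. Qed.

Definition smash_map : pointed_map (smash R X Y) (smash R X' Y') :=
  PointedMap smash_map_continuous smash_map_point.

End smash_map.

Program Definition smash_bifunctor : bifunctor (NG0 R) (NG0 R) (NG0 R) := {|
  bf_obj := smash_obj;
  bf_map := fun X X' Y Y' f g => smash_map f g
|}.
Next Obligation.
move=> X Y; apply: pointed_mapP => u.
by rewrite -[u]reprK /= smash_map_pi /= -surjective_pairing.
Qed.
Next Obligation.
move=> X X' X'' Y Y' Y'' f' f g' g; apply: pointed_mapP => u.
rewrite -[u]reprK [LHS]smash_map_pi [RHS]/=.
by rewrite [X in smash_map_fun f' g' X]smash_map_pi [RHS]smash_map_pi.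
Qed.

End smash_functor.

Definition map_space (X Y : topologicalType) : topologicalType :=
  initial_topology (id : continuousType X Y -> {compact-open, X -> Y}).

Definition numerically_continuous (R : realType) (X Y : topologicalType)
    (f : X -> Y) : Prop :=
  forall (n : nat) (s : simplex R n -> X), continuous s -> continuous (f \o s).

Section smap.
Variables (R : realType) (X Y : topologicalType).

Definition smap : Type := [set f : X -> Y | numerically_continuous R f].

HB.instance Definition _ := gen_eqMixin smap.
HB.instance Definition _ := gen_choiceMixin smap.

Definition smap_fun (f : smap) : X -> Y := sval f.

Lemma smapP (f : smap) : numerically_continuous R (smap_fun f).
Proof. exact: set_mem (svalP f). Qed.

Lemma smap_ext (f g : smap) : smap_fun f =1 smap_fun g -> f = g.
Proof. by move=> /funext fg; apply: eq_sig_hprop => //= ? ? ?. Qed.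

(** [smap_pull s] is precomposition with the singular simplex [s]. *)
Definition smap_pull (s : {n & continuousType (simplex R n) X}) (f : smap) :
    map_space (simplex R (projT1 s)) Y :=
  mkcts (@smapP f _ _ (@cts_fun _ _ (projT2 s))).

(** The initial topology with respect to the family of all [smap_pull s] is the
    supremum of the initial topologies with respect to each of them. *)
HB.instance Definition _ := Topological.copy smap
  (sup_topology (fun s => Topological.class (initial_topology (smap_pull s)))).

Lemma smap_pull_continuous s : continuous (smap_pull s).
Proof.
move=> f.
have fs : nbhs f --> (f : initial_topology (smap_pull s)).
  have := @cvg_sup _ _ (fun s => Topological.class
    (initial_topology (smap_pull s))) (nbhs f) f (nbhs_filter _).
  by case=> /(_ (@cvg_id _ _))/(_ s).
apply: (cvg_trans (cvg_app (smap_pull s) fs)).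
exact: (@initial_continuous _ _ (smap_pull s)).
Qed.

Lemma continuous_to_smap (T : topologicalType) (h : T -> smap) :
  (forall s, continuous (smap_pull s \o h)) -> continuous h.
Proof.
move=> ch t; apply/(@cvg_sup _ _ _ _ _ (fmap_filter _ _)) => s.
exact: (@continuous_comp_initial _ _ _ (smap_pull s) h (ch s) t).
Qed.

End smap.

Section smap0.
Variables (R : realType) (Y Z : ptopologicalType).

Definition smap0_set : set (smap R Y Z) := [set f | smap_fun f point = point].
Definition smap0 : Type := smap0_set.

HB.instance Definition _ := Topological.copy smap0 (set_type smap0_set).

Lemma cst_numerically_continuous :
  [set f : Y -> Z | numerically_continuous R f] (cst point).
Proof. by move=> n s _; exact: (@cst_continuous _ Z point). Qed.

Definition smap_cst : smap R Y Z := to_set_type cst_numerically_continuous.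

Lemma smap_cst_point : smap0_set smap_cst.
Proof. by []. Qed.

HB.instance Definition _ :=
  isPointed.Build smap0 (to_set_type smap_cst_point).

Definition smap0_fun (f : smap0) : Y -> Z := smap_fun (sval f).

Lemma smap0_ext (f g : smap0) : smap0_fun f =1 smap0_fun g -> f = g.
Proof. by move=> /smap_ext fg; apply: eq_sig_hprop => //= ? ? ?. Qed.

Lemma smap0_point (f : smap0) : smap0_fun f point = point.
Proof. exact: set_mem (svalP f). Qed.

End smap0.

Section exp_functor.
Variable R : realType.

Definition exp_obj (Y Z : NG0 R) : NG0 R :=
  @NG0Space R (nu R (smap0 R Y Z)) (@nu_numerically_generated R _).

Section exp_map.
Variables (Y Y' Z Z' : ptopologicalType).
Variables (b : pointed_map Y' Y) (c : pointed_map Z Z').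

Lemma exp_map_numerically_continuous (f : smap R Y Z) :
  [set h : Y' -> Z' | numerically_continuous R h] (c \o smap_fun f \o b).
Proof.
move=> n s cs t.
apply: (@continuous_comp _ _ _ (smap_fun f \o (b \o s)) c).
  apply: (@smapP _ _ _ f n (b \o s)) => u.
  by apply: continuous_comp; [exact: cs|exact: pmap_continuous].
exact: pmap_continuous.
Qed.

Definition exp_map_smap (f : smap R Y Z) : smap R Y' Z' :=
  to_set_type (@exp_map_numerically_continuous f).

Lemma exp_map_smap0 (f : smap0 R Y Z) : smap0_set (exp_map_smap (sval f)).
Proof.
by rewrite /smap0_set /= pmap_point [X in c X]smap0_point pmap_point.
Qed.

Definition exp_map_fun (f : smap0 R Y Z) : smap0 R Y' Z' :=
  to_set_type (exp_map_smap0 f).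


Let exp_map_smap_continuous : continuous exp_map_smap.
Proof.
apply: continuous_to_smap => -[n s]; apply: continuous_comp_initial => f.
apply/(@compact_open_cvgP _ _ _ _ (fmap_filter _ (nbhs_filter f))) => K U cK oU fKU.
have cbs : continuous (b \o s).
  by move=> t; apply: continuous_comp; [exact: cts_fun|exact: pmap_continuous].
pose bs : {n & continuousType (simplex R n) Y} :=
  existT _ n (mkcts cbs : continuousType (simplex R n) Y).
pose pull (g : smap R Y Z) : {compact-open, simplex R n -> Z} :=
  smap_pull bs g.
have pull_cvg : pull @ f --> pull f.
  apply: (@continuous_comp _ _ _ (smap_pull bs)
    (id : map_space _ _ -> {compact-open, simplex R n -> Z})).
    exact: smap_pull_continuous.
  exact: initial_continuous.
have nf : (pull @ f) [set g | g @` K `<=` c @^-1` U].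
  apply: ((@compact_open_cvgP _ _ (pull @ f) (pull f)
    (fmap_filter _ (nbhs_filter f))).1 pull_cvg K (c @^-1` U) cK).
    by move/continuousP : (@pmap_continuous _ _ c); apply.
  by move=> _ [t Kt <-]; apply: fKU; exists t.
apply: (@filterS _ (nbhs f) _ _ _ _ nf) => g gKU _ [t Kt <-].
by apply: (gKU (pull g t)); exists t.
Qed.

Lemma exp_map_continuous : continuous exp_map_fun.
Proof.
apply: continuous_comp_initial => f.
apply: (@continuous_comp _ _ _ (set_val : smap0 R Y Z -> smap R Y Z)
  exp_map_smap).
  exact: (@initial_continuous _ _ (set_val : smap0 R Y Z -> smap R Y Z)).
exact: exp_map_smap_continuous.
Qed.

Lemma exp_map_point : exp_map_fun point = point.
Proof. by apply: smap0_ext => y; exact: pmap_point. Qed.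

Definition exp_map :
    pointed_map (nu R (smap0 R Y Z)) (nu R (smap0 R Y' Z')) :=
  @PointedMap (nu R (smap0 R Y Z)) (nu R (smap0 R Y' Z')) exp_map_fun
    (nu_continuous exp_map_continuous) exp_map_point.

End exp_map.

Program Definition exp_bifunctor :
    bifunctor (opposite (NG0 R)) (NG0 R) (NG0 R) := {|
  bf_obj := exp_obj;
  bf_map := fun Y Y' Z Z' (b : pointed_map Y' Y) c => exp_map b c
|}.
Next Obligation.
by move=> Y Z; apply: pointed_mapP => f; exact: smap0_ext.
Qed.
Next Obligation.
by move=> Y Y' Y'' Z Z' Z'' b' b c' c; apply: pointed_mapP => f;
  exact: smap0_ext.
Qed.

End exp_functor.

(* Main.v *)
From HB Require Import structures.
Require Import Defs.
From mathcomp Require Import all_boot all_order all_algebra.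
From mathcomp Require Import all_classical reals topology normedtype.
From mathcomp Require Import lra.

(** The heart of the matter is an exponential law: for [X] numerically
    generated, a function on [nu (X * Y)] is continuous if and only if its
    transpose [X -> smap Y Z] is (lemmas [smap_curry_continuous] and
    [smap_uncurry_continuous]).  Both sides can be tested on simplexes
    [s] of [X] and [t] of [Y], which reduces the law to the one for maps
    [simplex n * simplex m -> Z] and the compact-open topology.

    Two facts about simplexes enter, and both follow from the existence of a
    continuous retraction of a Euclidean space onto each simplex, a property
    shared by products of simplexes.  Such a retract [K] does not distinguish
    [X] from [nu X], because a map [K -> X] extends to a map from a Euclidean
    space, which is one of the maps that define the topology of [nu X]; and
    evaluation [map_space K Z * K -> Z] is jointly continuous, because closed
    boxes are compact neighbourhoods in the Euclidean space.

    The exponential law has two consequences.  Restricted to pointed maps it is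
    the adjunction between [smash] and the internal hom.  And a product of a
    quotient map with an identity is again final among the products formed
    with [nu] (lemma [quotient_prod_continuous]): to check that a function on
    the target is continuous, transpose it and use that the quotient map is
    final.  This makes the associator of [smash] continuous, since a function
    on [(X /\ Y) * Z] may be tested on [(X * Y) * Z].  The inverse of the
    associator is then a composite of the associator with braidings.  All
    equations between maps of smash products (naturality, triangle, pentagon,
    hexagon) hold because both sides agree on the classes
    [smash_pair x y], which exhaust the smash product. *)

Set Implicit Arguments.
Unset Strict Implicit.
Unset Printing Implicit Defensive.

Import Order.TTheory GRing.Theory Num.Theory.
Import numFieldNormedType.Exports.

Local Open Scope classical_set_scope.
Local Open Scope ring_scope.
Local Open Scope quotient_scope.

(** * Retracts of Euclidean spaces *)

Lemma comp_continuous (X Y Z : topologicalType) (f : X -> Y) (g : Y -> Z) :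
  continuous f -> continuous g -> continuous (g \o f).
Proof. by move=> cf cg x; apply: continuous_comp; [exact: cf|exact: cg]. Qed.

Lemma pair_continuous (X Y Z : topologicalType) (f : X -> Y) (g : X -> Z) :
  continuous f -> continuous g -> continuous (fun x => (f x, g x)).
Proof. by move=> cf cg x; apply: cvg_pair; [exact: cf|exact: cg]. Qed.

Lemma fst_continuous (X Y : topologicalType) : continuous (@fst X Y).
Proof. by move=> p; exact: cvg_fst. Qed.

Lemma snd_continuous (X Y : topologicalType) : continuous (@snd X Y).
Proof. by move=> p; exact: cvg_snd. Qed.

Section euclidean_retracts.
Variable R : realType.

Definition euclidean_retract (K : topologicalType) : Prop :=
  exists N (i : K -> 'rV[R]_N) (r : 'rV[R]_N -> K),
    [/\ continuous i, continuous r & cancel i r].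

Section simplex_retraction.
Variable n : nat.
Implicit Type x : 'rV[R]_n.+1.

Let pos_sum x : R := \sum_i Num.max (x 0 i) 0.

(* Negative coordinates are cut off.  A deficit of the remaining sum with
   respect to 1 is spread evenly over all coordinates, an excess is removed by
   normalization; unlike plain normalization this is defined everywhere. *)
Let retraction x : 'rV[R]_n.+1 :=
  \row_i ((Num.max (x 0 i) 0 + Num.max (1 - pos_sum x) 0 / n.+1%:R) /
          Num.max (pos_sum x) 1).

Let max1_gt0 (a : R) : 0 < Num.max a 1.
Proof. by rewrite lt_max ltr01 orbT. Qed.

Let retraction_simplex x : simplex R n (retraction x).
Proof.
split=> [i|].
  rewrite mxE divr_ge0 ?(ltW (max1_gt0 _))// addr_ge0 ?le_max ?lexx ?orbT//.
  by rewrite divr_ge0// le_max lexx orbT.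
rewrite (eq_bigr (fun i => (Num.max (x 0 i) 0 +
  Num.max (1 - pos_sum x) 0 / n.+1%:R) / Num.max (pos_sum x) 1)); last first.
  by move=> i _; rewrite mxE.
rewrite -mulr_suml big_split/= sumr_const card_ord -/(pos_sum x).
rewrite -[_ *+ n.+1]mulr_natr divfK ?pnatr_eq0//.
have [s_le1|s_gt1] := leP (pos_sum x) 1.
  rewrite (max_idPl _) ?subr_ge0//.
  by rewrite invr1 mulr1 addrC subrK.
rewrite (max_idPr _) ?subr_le0 ?(ltW s_gt1)// addr0.
by rewrite divff// gt_eqF// (lt_trans ltr01).
Qed.

Let retraction_id x : simplex R n x -> retraction x = x.
Proof.
move=> [x_ge0 x1]; have xE i : Num.max (x 0 i) 0 = x 0 i.
  by apply/max_idPl.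
have sE : pos_sum x = 1 by rewrite -[RHS]x1; apply: eq_bigr => i _.
apply/rowP => i; rewrite mxE sE xE subrr !maxxx mul0r addr0.
by rewrite invr1 mulr1.
Qed.

Let retraction_continuous : continuous retraction.
Proof.
have max_continuous (T : topologicalType) (f : T -> R) (a : R) :
    continuous f -> continuous (fun t => Num.max (f t) a).
  move=> cf; apply: (@max_fun_continuous _ T R f (cst a)) => //.
  exact: cst_continuous.
have cpos : continuous pos_sum.
  move=> x; apply: (@cvg_big _ _ _ _ _ add_continuous _ (nbhs x)) => k _.
  by apply: max_continuous; exact: coord_continuous.
apply: continuous_mx => i j x.
rewrite (_ : (fun _ => _) = fun x => (Num.max (x 0 j) 0 +
    Num.max (1 - pos_sum x) 0 / n.+1%:R) / Num.max (pos_sum x) 1); last first.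
  by apply/funext => y; rewrite mxE.
apply: (@cvgM _ _ (nbhs x)); last first.
  by apply: (@cvgV _ _ (nbhs x)); [exact: lt0r_neq0|exact: max_continuous].
apply: (@cvgD _ _ _ (nbhs x)); first
  by apply: max_continuous; exact: coord_continuous.
apply: (@cvgM _ _ (nbhs x)); last exact: cvg_cst.
apply: (max_continuous _ (fun y => 1 - pos_sum y)) => y.
by apply: (@cvgB _ _ _ (nbhs y)); [exact: cvg_cst|exact: cpos].
Qed.

Lemma simplex_euclidean_retract : euclidean_retract (simplex R n).
Proof.
exists n.+1, val, (fun x => to_set_type (retraction_simplex x)); split.
- exact: initial_continuous.
- by apply: continuous_comp_initial; exact: retraction_continuous.
- by move=> t; apply: val_inj; apply: retraction_id; exact: set_mem (valP t).
Qed.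

End simplex_retraction.

Lemma prod_euclidean_retract (K L : topologicalType) :
  euclidean_retract K -> euclidean_retract L -> euclidean_retract (K * L)%type.
Proof.
move=> [M [i [r [ci cr ir]]]] [N [j [s [cj cs js]]]].
exists (M + N)%N, (fun p => row_mx (i p.1) (j p.2)),
  (fun x => (r (lsubmx x), s (rsubmx x))); split.
- apply: continuous_mx => k l; rewrite ord1.
  under eq_fun do rewrite mxE.
  case: splitP => [l' _|l' _].
    apply: (comp_continuous _ (@coord_continuous _ _ _ 0 l')).
    exact: (comp_continuous (@fst_continuous _ _) ci).
  apply: (comp_continuous _ (@coord_continuous _ _ _ 0 l')).
  exact: (comp_continuous (@snd_continuous _ _) cj).
- apply: pair_continuous.
    apply: (comp_continuous _ cr); apply: continuous_mx => k l.
    under eq_fun do rewrite mxE.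
    exact: coord_continuous.
  apply: (comp_continuous _ cs); apply: continuous_mx => k l.
  under eq_fun do rewrite mxE.
  exact: coord_continuous.
- by move=> [k l] /=; rewrite row_mxKl row_mxKr ir js.
Qed.

(** Precomposition with the retraction turns [f] into a map from a Euclidean
    space, and along such maps the sets open in [nu R X] are open by
    definition. *)
Lemma retract_continuous_to_nu (K X : topologicalType) (f : K -> X) :
  euclidean_retract K -> continuous f -> continuous (f : K -> nu R X).
Proof.
move=> [N [i [r [ci cr ir]]]] cf; apply/continuousP => U oU.
have cfr : continuous (fun x : [set: 'rV[R]_N] => f (r (val x))).
  apply: (comp_continuous _ cf); apply: (comp_continuous _ cr).
  exact: initial_continuous.
have oV := oU N setT _ openT cfr.
pose e (k : K) : [set: 'rV[R]_N] := to_set_type (I : setT (i k)).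
have ce : continuous e by apply: continuous_comp_initial; exact: ci.
rewrite (_ : f @^-1` U = e @^-1` ((fun x => f (r (val x))) @^-1` U)).
  by move/continuousP : ce; apply.
by apply/seteqP; split=> k /=; rewrite ir.
Qed.

(** A retract of a Euclidean space has enough compact sets for the
    compact-open topology to control values at variable points: the image
    under the retraction of a small box around a point contains all nearby
    points. *)
Lemma retract_continuous_eval (T K Z : topologicalType)
    (h : T -> map_space K Z) :
  euclidean_retract K -> continuous h ->
  continuous (fun p : T * K => (h p.1 : K -> Z) p.2).
Proof.
move=> [N [i [r [ci cr ir]]]] ch [u k] /= O.
rewrite nbhsE => -[O' [oO' O'hk] /filterS]; apply.
have chr : continuous ((h u : K -> Z) \o r).
  by move=> x; apply: continuous_comp; [exact: cr|exact: cts_fun].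
have [e e0 eO] : exists2 e : R, 0 < e &
    ball (i k) e `<=` ((h u : K -> Z) \o r) @^-1` O'.
  apply/nbhs_ballP; apply: chr; apply: open_nbhs_nbhs; split=> //.
  by rewrite /= ir.
pose B := [set x : 'rV[R]_N |
  forall j, `[i k 0 j - e / 2, i k 0 j + e / 2]%classic (x 0 j)].
have cB : compact B.
  apply: (@rV_compact _ _
    (fun j => `[i k 0 j - e / 2, i k 0 j + e / 2]%classic)) => j.
  exact: segment_compact.
have BO : B `<=` ((h u : K -> Z) \o r) @^-1` O'.
  move=> x Bx; apply: eO; split=> // a j; rewrite ord1 /ball/=.
  have := Bx j; rewrite /= in_itv/= => /andP[? ?].
  by rewrite ltr_norml; apply/andP; split; lra.
have nB : nbhs (i k) B.
  apply/nbhs_ballP; exists (e / 2); first by rewrite /= divr_gt0.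
  move=> x [_ /= bx] j; have := bx 0 j.
  rewrite /ball/= in_itv/= ltr_norml => /andP[? ?].
  by apply/andP; split; lra.
(* [r @` B] is a compact neighbourhood of [k] in [K]: it contains
   [i @^-1` B]. *)
have crB : compact (r @` B).
  by apply: continuous_compact => //; exact: continuous_subspaceT.
have nu : nbhs u [set v | (h v : K -> Z) @` (r @` B) `<=` O'].
  have hu : (h v : {compact-open, K -> Z}) @[v --> u] -->
      (h u : {compact-open, K -> Z}).
    apply: (@continuous_comp _ _ _ h
      (id : map_space _ _ -> {compact-open, K -> Z})).
      exact: ch.
    exact: initial_continuous.
  apply: ((compact_open_cvgP _ _).1 hu _ _ crB oO').
  by move=> _ [_ [x Bx <-] <-]; exact: BO.
exists ([set v | (h v : K -> Z) @` (r @` B) `<=` O'], i @^-1` B).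
  by split=> //; exact: ci.
move=> [v l] /= [vO Bl]; apply: vO; exists l => //; exists (i l) => //.
Qed.

End euclidean_retracts.

(** * Numerically generated spaces and the exponential law *)

Section numerically_generated_category.
Variable R : realType.

Lemma numerically_generated_continuous (X Y : topologicalType) (f : X -> Y) :
  numerically_generated R X -> numerically_continuous R f -> continuous f.
Proof.
move=> ngX nf; apply/continuousP => U oU; apply/ngX => n s cs.
by move/continuousP : (nf n s cs); apply.
Qed.

Lemma nu_id_continuous (X : topologicalType) :
  continuous (id : nu R X -> X).
Proof.
apply/continuousP => U oU.
change (nu_open (U : set (nu R X))) => n D f oD cf.
by move/continuousP : cf; apply.
Qed.

(** With [nu_id_continuous] this says that [nu] is right adjoint to the
    inclusion of the numerically generated spaces. *)
Lemma continuous_to_nu (W X : topologicalType) (f : W -> X) :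
  numerically_generated R W -> continuous f -> continuous (f : W -> nu R X).
Proof.
move=> ngW cf; apply: numerically_generated_continuous => // n s cs.
apply: (@retract_continuous_to_nu R _ _ (f \o s)).
  exact: simplex_euclidean_retract.
exact: comp_continuous.
Qed.

Lemma nu_fst_continuous (X Y : topologicalType) :
  continuous (fst : nu R (X * Y)%type -> X).
Proof.
exact: comp_continuous (@nu_id_continuous (X * Y)%type)
  (@fst_continuous _ _).
Qed.

Lemma nu_snd_continuous (X Y : topologicalType) :
  continuous (snd : nu R (X * Y)%type -> Y).
Proof.
exact: comp_continuous (@nu_id_continuous (X * Y)%type)
  (@snd_continuous _ _).
Qed.

Lemma nu_pair_continuous (W X Y : topologicalType) (f : W -> X) (g : W -> Y) :
  numerically_generated R W -> continuous f -> continuous g ->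
  continuous (fun w => (f w, g w) : nu R (X * Y)%type).
Proof.
by move=> ngW cf cg; apply: continuous_to_nu => //; exact: pair_continuous.
Qed.

Section exponential_law.
Variables (X Y Z : topologicalType).

Lemma section_numerically_continuous (F : X * Y -> Z) (x : X) :
  continuous (F : nu R (X * Y)%type -> Z) ->
  numerically_continuous R (fun y => F (x, y)).
Proof.
move=> cF n s cs.
apply: (@comp_continuous _ _ _ (fun t => (x, s t) : nu R (X * Y)%type) F) => //.
apply: retract_continuous_to_nu; first exact: simplex_euclidean_retract.
by apply: pair_continuous => //; exact: cst_continuous.
Qed.

(** For simplexes [s] of [X] and [t] of [Y] the map [F] is continuous along
    [s] and [t] jointly, since their product is a Euclidean retract and so
    does not see the difference between [X * Y] and [nu R (X * Y)].  The
    compact-open transpose is then continuous. *)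
Lemma smap_curry_continuous (F : X * Y -> Z) (h : X -> smap R Y Z) :
  numerically_generated R X ->
  (forall x y, smap_fun (h x) y = F (x, y)) ->
  continuous (F : nu R (X * Y)%type -> Z) -> continuous h.
Proof.
move=> ngX hF cF; apply: continuous_to_smap => -[m t].
apply: numerically_generated_continuous => // n s cs.
have cFst : continuous (fun p => F (s p.1, t p.2)).
  apply: (@comp_continuous _ _ _
    (fun p => (s p.1, t p.2) : nu R (X * Y)%type) F) => //.
  apply: retract_continuous_to_nu.
    by apply: prod_euclidean_retract; exact: simplex_euclidean_retract.
  by apply: prod_map_continuous => //; exact: cts_fun.
apply: continuous_comp_initial.
rewrite (_ : _ \o _ = curry (fun p => F (s p.1, t p.2))).
  exact: continuous_curry_fun.
by apply/funext => u; apply/funext => v; exact: hF.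
Qed.

(** A simplex of [nu R (X * Y)] is a pair of simplexes with a common domain;
    along it the uncurried map is evaluation on the diagonal, composed with a
    continuous family of maps on the simplex. *)
Lemma smap_uncurry_continuous (h : X -> smap R Y Z) :
  continuous h ->
  continuous ((fun p => smap_fun (h p.1) p.2) : nu R (X * Y)%type -> Z).
Proof.
move=> ch; apply: numerically_generated_continuous => [|n s cs].
  exact: nu_numerically_generated.
have c1 : continuous (fst \o s) := comp_continuous cs (@nu_fst_continuous _ _).
have c2 : continuous (snd \o s) := comp_continuous cs (@nu_snd_continuous _ _).
pose t : {n & continuousType (simplex R n) Y} :=
  existT _ n (mkcts c2 : continuousType (simplex R n) Y).
have cp : continuous (smap_pull t \o (h \o (fst \o s))).
  exact: comp_continuous (comp_continuous c1 ch)
    (@smap_pull_continuous _ _ _ t).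
have ce := retract_continuous_eval (simplex_euclidean_retract R n) cp.
apply: (@comp_continuous _ _ _ (fun u => (u, u)) _ _ ce).
by apply: pair_continuous => u; exact: cvg_id.
Qed.

End exponential_law.

(** The transpose of [g] is a map [B -> smap R C Z], and its continuity can be
    tested after composition with [q]; this is the usual reason why a functor
    with a right adjoint preserves quotient maps. *)
Lemma quotient_prod_continuous (A B C Z : topologicalType) (q : A -> B)
    (g : B * C -> Z) :
  numerically_generated R A ->
  (forall b, exists a, q a = b) ->
  (forall (W : topologicalType) (f : B -> W),
     continuous (f \o q) -> continuous f) ->
  continuous ((fun p => g (q p.1, p.2)) : nu R (A * C)%type -> Z) ->
  continuous (g : nu R (B * C)%type -> Z).
Proof.
move=> ngA q_surj q_final cg.
have ng b : [set f : C -> Z | numerically_continuous R f] (fun c => g (b, c)).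
  have [a <-] := q_surj b => n s.
  exact: (@section_numerically_continuous _ _ _ _ a cg n s).
pose h b : smap R C Z := to_set_type (ng b).
have ch : continuous h by apply/q_final/(smap_curry_continuous _ _ cg).
rewrite (_ : g = fun p => smap_fun (h p.1) p.2).
  exact: smap_uncurry_continuous.
by apply/funext => -[].
Qed.

End numerically_generated_category.

(** * Maps out of smash products *)

(** Locked, like [smash_rec] below, so that rewriting with the computation
    rules on generators does not unfold maps of smash products down to
    representatives. *)
HB.lock Definition smash_pair (R : realType) (X Y : ptopologicalType)
    (x : X) (y : Y) : smash R X Y :=
  \pi_(smash R X Y) ((x, y) : nu R (X * Y)%type).

Section smash_elements.
Variables (R : realType) (X Y : ptopologicalType).
Local Notation smash_pair := (@smash_pair R X Y).

Lemma smash_pairE x y : smash_pair x y = \pi_(smash R X Y) (x, y).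
Proof. by rewrite unlock. Qed.

Lemma smash_pair_ind (P : smash R X Y -> Prop) :
  (forall x y, P (smash_pair x y)) -> forall u, P u.
Proof.
move=> Ppair u; rewrite -[u]reprK; case: (repr u) => x y.
by rewrite -smash_pairE; exact: Ppair.
Qed.

Lemma smash_pair_continuous :
  continuous ((fun p => smash_pair p.1 p.2) : nu R (X * Y)%type -> smash R X Y).
Proof.
rewrite (_ : (fun _ => _) = \pi_(smash R X Y)); first exact: pi_continuous.
by apply/funext => -[x y]; rewrite smash_pairE.
Qed.

Lemma smash_pairx0 x : smash_pair x point = point.
Proof. by rewrite smash_pairE; apply/smash_eqP; right; split; left. Qed.

Lemma smash_pair0x y : smash_pair point y = point.
Proof. by rewrite smash_pairE; apply/smash_eqP; right; split; [right|left]. Qed.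

Section final.
Variables (Z : topologicalType) (f : smash R X Y -> Z).

Lemma smash_continuous :
  continuous ((fun p => f (smash_pair p.1 p.2)) : nu R (X * Y)%type -> Z) ->
  continuous f.
Proof.
move=> cf; apply/continuousP => U oU.
change (open (\pi_(smash R X Y) @^-1` (f @^-1` U))).
rewrite (_ : _ @^-1` _ = (fun p => f (smash_pair p.1 p.2)) @^-1` U).
  by move/continuousP : cf; apply.
by apply/seteqP; split=> -[x y] /=; rewrite smash_pairE.
Qed.

End final.

(** The product [smash R X Y * C] carries no evident quotient topology; this
    is where the exponential law is needed for associativity. *)
Lemma smash_prod_continuous (C Z : topologicalType)
    (g : smash R X Y * C -> Z) :
  continuous ((fun p => g (smash_pair p.1.1 p.1.2, p.2)) :
    nu R (nu R (X * Y)%type * C)%type -> Z) ->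
  continuous (g : nu R (smash R X Y * C)%type -> Z).
Proof.
apply: (@quotient_prod_continuous R (nu R (X * Y)%type) _ _ _
  (fun p => smash_pair p.1 p.2)) => [|u|W f].
- exact: nu_numerically_generated.
- by elim/smash_pair_ind: u => x y; exists (x, y).
- exact: smash_continuous.
Qed.

End smash_elements.

HB.lock Definition smash_rec (R : realType) (X Y : ptopologicalType)
    (T : Type) (F : X -> Y -> T) (u : smash R X Y) : T :=
  F (repr u).1 (repr u).2.

Section smash_lift.
Variables (R : realType) (X Y : ptopologicalType).

Lemma smash_recE (T : Type) (F : X -> Y -> T) (t : T) :
  (forall x, F x point = t) -> (forall y, F point y = t) ->
  forall x y, smash_rec F (smash_pair R x y) = F x y.
Proof.
move=> Fx0 F0y x y.
have Fwedge (p : nu R (X * Y)%type) : wedge_in_prod p -> F p.1 p.2 = t.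
  by case=> ->.
rewrite smash_pairE smash_rec.unlock.
have /smash_eqP[|] : \pi_(smash R X Y) (repr (\pi_(smash R X Y) (x, y))) =
    \pi_(smash R X Y) (x, y) by rewrite reprK.
  by move=> ->.
by move=> [/Fwedge -> /Fwedge /= ->].
Qed.

Section lift.
Variables (Z : ptopologicalType) (F : X -> Y -> Z).
Hypothesis F_continuous :
  continuous ((fun p => F p.1 p.2) : nu R (X * Y)%type -> Z).
Hypothesis Fx0 : forall x, F x point = point.
Hypothesis F0y : forall y, F point y = point.

Lemma smash_rec_continuous : continuous (@smash_rec R X Y Z F).
Proof.
apply: smash_continuous.
rewrite (_ : (fun _ => _) = fun p => F p.1 p.2)//.
by apply/funext => -[x y]; exact: (smash_recE Fx0).
Qed.

Lemma smash_rec_point : @smash_rec R X Y Z F point = point.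
Proof. by rewrite -(smash_pairx0 R Y (point : X)) (smash_recE Fx0). Qed.

Definition smash_lift : pointed_map (smash R X Y) Z :=
  PointedMap smash_rec_continuous smash_rec_point.

Lemma smash_liftE x y : smash_lift (smash_pair R x y) = F x y.
Proof. exact: (smash_recE Fx0). Qed.

End lift.
End smash_lift.

Lemma pmap_compE (X Y Z : ptopologicalType) (g : pointed_map Y Z)
    (f : pointed_map X Y) (x : X) : pmap_comp g f x = g (f x).
Proof. by []. Qed.

Lemma smash_mapE (R : realType) (X X' Y Y' : ptopologicalType)
    (f : pointed_map X X') (g : pointed_map Y Y') (x : X) (y : Y) :
  smash_map R f g (smash_pair R x y) = smash_pair R (f x) (g y).
Proof. by rewrite !smash_pairE; exact: smash_map_pi. Qed.

(** * The symmetric monoidal structure *)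

Section smash_associator.
Variables (R : realType) (X Y Z : ptopologicalType).

Let reassoc (u : smash R X Y) (z : Z) : smash R X (smash R Y Z) :=
  smash_rec (fun x y => smash_pair R x (smash_pair R y z)) u.

Let reassocE x y z :
  reassoc (smash_pair R x y) z = smash_pair R x (smash_pair R y z).
Proof.
apply: (@smash_recE _ _ _ _ _ point) => [x'|y']; last exact: smash_pair0x.
by rewrite smash_pair0x smash_pairx0.
Qed.

Let reassoc_continuous :
  continuous ((fun p => reassoc p.1 p.2) :
    nu R (smash R X Y * Z)%type -> smash R X (smash R Y Z)).
Proof.
apply: smash_prod_continuous => /=.
rewrite (_ : (fun _ => _) = fun p : nu R (nu R (X * Y)%type * Z)%type =>
    smash_pair R p.1.1 (smash_pair R p.1.2 p.2)); last first.
  by apply/funext => -[[x y] z]; exact: reassocE.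
have ngW := @nu_numerically_generated R (nu R (X * Y)%type * Z)%type.
have c12 := @nu_fst_continuous R (nu R (X * Y)%type) Z.
have c3 := @nu_snd_continuous R (nu R (X * Y)%type) Z.
have c1 := comp_continuous c12 (@nu_fst_continuous R X Y).
have c2 := comp_continuous c12 (@nu_snd_continuous R X Y).
have c23 := comp_continuous (nu_pair_continuous ngW c2 c3)
  (@smash_pair_continuous R Y Z).
exact: comp_continuous (nu_pair_continuous ngW c1 c23)
  (@smash_pair_continuous R X (smash R Y Z)).
Qed.

Let reassocx0 u : reassoc u point = point.
Proof.
by elim/smash_pair_ind: u => x y; rewrite reassocE !smash_pairx0.
Qed.

Let reassoc0x z : reassoc point z = point.
Proof. by rewrite -(smash_pairx0 R Y (point : X)) reassocE !smash_pair0x. Qed.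

Definition smash_assoc :
    pointed_map (smash R (smash R X Y) Z) (smash R X (smash R Y Z)) :=
  smash_lift reassoc_continuous reassocx0 reassoc0x.

Lemma smash_assocE x y z :
  smash_assoc (smash_pair R (smash_pair R x y) z) =
  smash_pair R x (smash_pair R y z).
Proof. by rewrite /smash_assoc smash_liftE; exact: reassocE. Qed.

End smash_associator.

Section smash_braiding.
Variables (R : realType) (X Y : ptopologicalType).

Lemma smash_swap_continuous :
  continuous ((fun p => smash_pair R p.2 p.1) :
    nu R (X * Y)%type -> smash R Y X).
Proof.
exact: comp_continuous (nu_pair_continuous (@nu_numerically_generated R _)
  (@nu_snd_continuous R X Y) (@nu_fst_continuous R X Y))
  (@smash_pair_continuous R Y X).
Qed.

Definition smash_braid : pointed_map (smash R X Y) (smash R Y X) :=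
  @smash_lift R X Y _ (fun x y => smash_pair R y x) smash_swap_continuous
    (@smash_pair0x R Y X) (@smash_pairx0 R Y X).

Lemma smash_braidE x y :
  smash_braid (smash_pair R x y) = smash_pair R y x.
Proof. exact: smash_liftE. Qed.

End smash_braiding.

Section smash_unitor.
Variables (R : realType) (X : ptopologicalType).

(* The point of [bool] is [false], so that [true] is the unit element. *)
Let scale (b : bool) (x : X) : X := if b then x else point.

Let scale_continuous :
  continuous ((fun p => scale p.1 p.2) : nu R (bool * X)%type -> X).
Proof.
apply: (@comp_continuous (nu R (bool * X)%type) (bool * X)%type X id
  ((fun p => scale p.1 p.2) : bool * X -> X)); first exact: nu_id_continuous.
move=> [b x].
have nb : nbhs (b, x) (fst @^-1` [set b]).
  by apply: fst_continuous; exact: discrete_set1.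
case: b nb => nb.
  apply: cvg_trans (@snd_continuous bool X (true, x)).
  apply: near_eq_cvg.
  by apply: filterS nb => -[b' x'] /= ->.
apply: cvg_trans (@cst_continuous (bool * X)%type X point (false, x)).
apply: near_eq_cvg.
by apply: filterS nb => -[b' x'] /= ->.
Qed.

Let scalex0 b : scale b point = point.
Proof. by case: b. Qed.

Let scale0x x : scale point x = point.
Proof. by []. Qed.

Definition smash_lunit : pointed_map (smash R bool X) X :=
  smash_lift scale_continuous scalex0 scale0x.

Lemma smash_lunitE b x :
  smash_lunit (smash_pair R b x) = if b then x else point.
Proof. exact: smash_liftE. Qed.

Definition smash_runit : pointed_map (smash R X bool) X :=
  pmap_comp smash_lunit (smash_braid R X bool).

Lemma smash_runitE x b :
  smash_runit (smash_pair R x b) = if b then x else point.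
Proof. by rewrite pmap_compE smash_braidE smash_lunitE. Qed.

Hypothesis ngX : numerically_generated R X.

Lemma smash_lunit_inv_continuous :
  continuous (fun x : X => smash_pair R true x).
Proof.
apply: (comp_continuous _ (@smash_pair_continuous R bool X)
  : continuous (_ \o (fun x : X => (true, x) : nu R (bool * X)%type))).
apply: nu_pair_continuous => //; first exact: cst_continuous.
by move=> x; exact: cvg_id.
Qed.

Definition smash_lunit_inv : pointed_map X (smash R bool X) :=
  PointedMap smash_lunit_inv_continuous (@smash_pairx0 R bool X true).

Lemma smash_lunitK : cancel smash_lunit smash_lunit_inv.
Proof.
elim/smash_pair_ind => -[] x; rewrite smash_lunitE//=.
by rewrite smash_pairx0 smash_pair0x.
Qed.

Lemma smash_lunit_invK : cancel smash_lunit_inv smash_lunit.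
Proof. by move=> x; rewrite smash_lunitE. Qed.

End smash_unitor.

Section smash_coherence.
Variable R : realType.
Implicit Types W X Y Z : ptopologicalType.

Lemma smash_braidK X Y : cancel (smash_braid R X Y) (smash_braid R Y X).
Proof. by elim/smash_pair_ind => x y; rewrite !smash_braidE. Qed.

(** Reversing the order of all three factors before and after turns the
    associator into its inverse: X(YZ), (YZ)X, (ZY)X, Z(YX), (YX)Z, (XY)Z.
    No second continuity argument is needed. *)
Definition smash_assoc_inv X Y Z :
    pointed_map (smash R X (smash R Y Z)) (smash R (smash R X Y) Z) :=
  pmap_comp (smash_map R (smash_braid R Y X) (pmap_id Z))
    (pmap_comp (smash_braid R Z (smash R Y X))
      (pmap_comp (smash_assoc R Z Y X)
        (pmap_comp (smash_map R (smash_braid R Y Z) (pmap_id X))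
          (smash_braid R X (smash R Y Z))))).

Lemma smash_assoc_invE X Y Z (x : X) (y : Y) (z : Z) :
  smash_assoc_inv X Y Z (smash_pair R x (smash_pair R y z)) =
  smash_pair R (smash_pair R x y) z.
Proof.
by rewrite !pmap_compE !(smash_braidE, smash_mapE, smash_assocE).
Qed.

Lemma smash_assocK X Y Z :
  cancel (smash_assoc R X Y Z) (smash_assoc_inv X Y Z).
Proof.
elim/smash_pair_ind => u z; elim/smash_pair_ind: u => x y.
by rewrite smash_assocE smash_assoc_invE.
Qed.

Lemma smash_assoc_invK X Y Z :
  cancel (smash_assoc_inv X Y Z) (smash_assoc R X Y Z).
Proof.
elim/smash_pair_ind => x u; elim/smash_pair_ind: u => y z.
by rewrite smash_assoc_invE smash_assocE.
Qed.

Lemma smash_assoc_nat X X' Y Y' Z Z' (f : pointed_map X X')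
    (g : pointed_map Y Y') (h : pointed_map Z Z') u :
  smash_assoc R X' Y' Z' (smash_map R (smash_map R f g) h u) =
  smash_map R f (smash_map R g h) (smash_assoc R X Y Z u).
Proof.
elim/smash_pair_ind: u => u z; elim/smash_pair_ind: u => x y.
by rewrite !(smash_mapE, smash_assocE).
Qed.

Lemma smash_lunit_nat X X' (f : pointed_map X X') u :
  smash_lunit R X' (smash_map R (pmap_id bool) f u) = f (smash_lunit R X u).
Proof.
elim/smash_pair_ind: u => -[] x; rewrite smash_mapE !smash_lunitE//=.
by rewrite pmap_point.
Qed.

Lemma smash_braid_nat X X' Y Y' (f : pointed_map X X')
    (g : pointed_map Y Y') u :
  smash_braid R X' Y' (smash_map R f g u) =
  smash_map R g f (smash_braid R X Y u).
Proof.
by elim/smash_pair_ind: u => x y; rewrite !(smash_mapE, smash_braidE).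
Qed.

Lemma smash_triangle X Y u :
  smash_map R (pmap_id X) (smash_lunit R Y) (smash_assoc R X bool Y u) =
  smash_map R (smash_runit R X) (pmap_id Y) u.
Proof.
elim/smash_pair_ind: u => u y; elim/smash_pair_ind: u => x b.
rewrite smash_assocE !smash_mapE smash_lunitE smash_runitE.
by case: b => //=; rewrite smash_pairx0 smash_pair0x.
Qed.

Lemma smash_pentagon W X Y Z u :
  smash_assoc R W X (smash R Y Z) (smash_assoc R (smash R W X) Y Z u) =
  smash_map R (pmap_id W) (smash_assoc R X Y Z)
    (smash_assoc R W (smash R X Y) Z
      (smash_map R (smash_assoc R W X Y) (pmap_id Z) u)).
Proof.
elim/smash_pair_ind: u => u z; elim/smash_pair_ind: u => u y.
elim/smash_pair_ind: u => w x.
by rewrite !(smash_mapE, smash_assocE).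
Qed.

Lemma smash_hexagon X Y Z u :
  smash_assoc R Y Z X (smash_braid R X (smash R Y Z) (smash_assoc R X Y Z u)) =
  smash_map R (pmap_id Y) (smash_braid R X Z)
    (smash_assoc R Y X Z (smash_map R (smash_braid R X Y) (pmap_id Z) u)).
Proof.
elim/smash_pair_ind: u => u z; elim/smash_pair_ind: u => x y.
by rewrite !(smash_mapE, smash_assocE, smash_braidE).
Qed.

Lemma pmap_is_iso (X Y : NG0_space R) (f : pointed_map X Y)
    (g : pointed_map Y X) :
  cancel f g -> cancel g f -> @is_iso (NG0 R) X Y f.
Proof. by move=> fK gK; exists g; split; exact: pointed_mapP. Qed.

Lemma bool_numerically_generated : numerically_generated R bool.
Proof.
move=> U; split=> [oU n s cs|_]; last exact: discrete_open.
by move/continuousP : cs; apply.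
Qed.

Definition sphere0 : NG0 R := NG0Space bool_numerically_generated.

Definition smash_symmetric_monoidal : symmetric_monoidal (smash_bifunctor R).
Proof.
unshelve refine (@Build_symmetric_monoidal (NG0 R) (smash_bifunctor R) sphere0
  (fun X Y Z : NG0_space R => smash_assoc R X Y Z)
  (fun X : NG0_space R => smash_lunit R X)
  (fun X : NG0_space R => smash_runit R X)
  (fun X Y : NG0_space R => smash_braid R X Y)
  _ _ _ _ _ _ _ _ _ _ _).
- move=> X Y Z; apply: (@pmap_is_iso (smash_obj (smash_obj X Y) Z)
    (smash_obj X (smash_obj Y Z))).
    exact: smash_assocK.
  exact: smash_assoc_invK.
- move=> X; apply: (@pmap_is_iso (smash_obj sphere0 X) X).
    exact: (smash_lunitK (@ng_numerically_generated R X)).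
  exact: smash_lunit_invK.
- move=> X; apply: (@pmap_is_iso (smash_obj X sphere0) X _
    (pmap_comp (smash_braid R bool X)
      (smash_lunit_inv (@ng_numerically_generated R X)))) => u.
    by rewrite pmap_compE smash_lunitK smash_braidK.
  by rewrite 2!pmap_compE smash_braidK smash_lunit_invK.
- move=> X X' Y Y' Z Z' f g h; apply: pointed_mapP; exact: smash_assoc_nat.
- move=> X X' f; apply: pointed_mapP; exact: smash_lunit_nat.
- move=> X X' f; apply: pointed_mapP => u.
  apply: etrans (smash_lunit_nat f (smash_braid R X bool u)).
  exact: congr1 (smash_braid_nat f (pmap_id bool) u).
- move=> X X' Y Y' f g; apply: pointed_mapP; exact: smash_braid_nat.
- move=> X Y; apply: pointed_mapP; exact: smash_triangle.
- move=> W X Y Z; apply: pointed_mapP; exact: smash_pentagon.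
- move=> X Y Z; apply: pointed_mapP; exact: smash_hexagon.
- move=> X Y; apply: pointed_mapP; exact: smash_braidK.
Defined.

End smash_coherence.

(** * The closed structure *)

Section smash_adjunction.
Variables (R : realType) (X Y Z : ptopologicalType).
Hypothesis ngX : numerically_generated R X.

Section smash_curry.
Variable f : pointed_map (smash R X Y) Z.

Let f_continuous : continuous ((fun p => f (smash_pair R p.1 p.2)) :
  nu R (X * Y)%type -> Z).
Proof.
exact: comp_continuous (@smash_pair_continuous R X Y) (@pmap_continuous _ _ f).
Qed.

Let section_smap x : [set h : Y -> Z | numerically_continuous R h]
  (fun y => f (smash_pair R x y)).
Proof.
by move=> n s; exact: (section_numerically_continuous (x := x) f_continuous).
Qed.

Let curry_smap x : smap R Y Z := to_set_type (@section_smap x).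

Let curry_smap_point x : smap0_set (curry_smap x).
Proof.
by rewrite /smap0_set /smap_fun /= smash_pairx0 pmap_point.
Qed.

Let curry_smap0 x : nu R (smap0 R Y Z) := to_set_type (@curry_smap_point x).

Let curry_smap0_continuous : continuous curry_smap0.
Proof.
apply: continuous_to_nu => //; apply: continuous_comp_initial.
exact: (smap_curry_continuous (h := curry_smap) ngX _ f_continuous).
Qed.

Let curry_smap0_point : curry_smap0 point = point.
Proof.
apply: smap0_ext => y.
by rewrite /smap0_fun /smap_fun /= smash_pair0x pmap_point.
Qed.

Definition smash_curry : pointed_map X (nu R (smap0 R Y Z)) :=
  PointedMap curry_smap0_continuous curry_smap0_point.

Lemma smash_curryE x y : smap0_fun (smash_curry x) y = f (smash_pair R x y).
Proof. by []. Qed.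

End smash_curry.

Section smash_uncurry.
Variable g : pointed_map X (nu R (smap0 R Y Z)).

Let uncurry_continuous :
  continuous ((fun p => smap0_fun (g p.1) p.2) : nu R (X * Y)%type -> Z).
Proof.
pose h := (set_val : smap0 R Y Z -> smap R Y Z) \o g.
have ch : continuous h.
  apply: (comp_continuous (@pmap_continuous _ _ g)).
  apply: (@comp_continuous (nu R (smap0 R Y Z)) (smap0 R Y Z) _ id).
    exact: nu_id_continuous.
  exact: initial_continuous.
exact: smap_uncurry_continuous ch.
Qed.

Let uncurry_point y : smap0_fun (g point) y = point.
Proof. by rewrite pmap_point. Qed.

Definition smash_uncurry : pointed_map (smash R X Y) Z :=
  @smash_lift R X Y Z (fun x y => smap0_fun (g x) y) uncurry_continuous
    (fun x => smap0_point (g x)) uncurry_point.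

Lemma smash_uncurryE x y :
  smash_uncurry (smash_pair R x y) = smap0_fun (g x) y.
Proof. exact: smash_liftE. Qed.

End smash_uncurry.

Lemma smash_curryK : cancel smash_curry smash_uncurry.
Proof.
move=> f; apply: pointed_mapP; elim/smash_pair_ind => x y.
by rewrite smash_uncurryE smash_curryE.
Qed.

Lemma smash_uncurryK : cancel smash_uncurry smash_curry.
Proof.
move=> g; apply: pointed_mapP => x; apply: smap0_ext => y.
by rewrite smash_curryE smash_uncurryE.
Qed.

End smash_adjunction.

Definition smash_monoidal_closed (R : realType) :
  monoidal_closed (smash_bifunctor R) (exp_bifunctor R).
Proof.
unshelve refine (@Build_monoidal_closed (NG0 R) (smash_bifunctor R)
  (exp_bifunctor R)
  (fun X Y Z : NG0_space R =>
    @smash_curry R X Y Z (@ng_numerically_generated R X)) _ _).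
- move=> X Y Z; exists (@smash_uncurry R X Y Z).
    exact: smash_curryK.
  exact: smash_uncurryK.
- move=> X X' Y Y' Z Z' a b c f; apply: pointed_mapP => x.
  apply: smap0_ext => y; rewrite [LHS]smash_curryE.
  by rewrite !pmap_compE smash_mapE.
Defined.

Theorem corollary5p3 (R : realType) :
  inhabited
    (symmetric_monoidal_closed (smash_bifunctor R) (exp_bifunctor R)).
Proof.
exact: (inhabits (Build_symmetric_monoidal_closed
  (smash_symmetric_monoidal R) (smash_monoidal_closed R))).
Qed.
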